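(* Let $H$ be a complex Hilbert space and let $f$ be a real function on $(0,\infty)$. If $f\in C^2((0,\infty))\cap\mathcal{D}^{(1)}$ and $\|f'(\cdot)\|$ is convex on $\sigma((0,\infty))$, then $$\begin{aligned} \left\|\nu f(A)+(1-\nu)f(B)-\int_0^1f((1-t)A+tB)\,dt\right\| \leq\ &\frac{1}{6}\left[2(1-\nu)^3-3(1-\nu)+2\right]\|f'(A)\|\,\|B-A\|\\ &+\frac{1}{6}\left(2\nu^3-3\nu+2\right)\|f'(B)\|\,\|B-A\| \end{aligned}$$ for all positive definite operators $A,B\in B(H)$ and all $0\leq\nu\leq1$.
   Context: $B(H)$ is the algebra of bounded linear operators on $H$, $\|\cdot\|$ is the operator norm, and $Sp(A)$ is the spectrum of $A$. For an interval $I$, $\sigma(I)$ is the set of self-adjoint $A\in B(H)$ with $Sp(A)\subseteq I$. A positive definite operator means a bounded self-adjoint operator $A$ with $\langle Ax,x\rangle>0$ for all $x\ne 0$ and $Sp(A)\subseteq(0,\infty)$. For continuous real $g$ on $I$ and $A\in\sigma(I)$, $g(A)$ is given by the continuous functional calculus, and $\|g(\cdot)\|$ denotes the map $\sigma(I)\to[0,\infty)$, $A\mapsto\|g(A)\|$. Convexity of $\|f'(\cdot)\|$ means $\|f'((1-t)A+tB)\|\le(1-t)\|f'(A)\|+t\|f'(B)\|$ for all $A,B\in\sigma((0,\infty))$, $t\in[0,1]$. $Df(A)$ is the Fréchet derivative at $A$ of the map $X\mapsto f(X)$, a linear operator on the space of bounded self-adjoint operators, with norm $\|Df(A)\|=\sup\{\|Df(A)(B)\|:\|B\|=1\}$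 ($B$ self-adjoint). $\mathcal{D}^{(1)}$ is the set of functions $f$ on $(0,\infty)$ with $\|Df(A)\|=\|f'(A)\|$ for all positive definite operators $A$. *)

(* Defs.v *)
From Stdlib Require Import Reals Lra ClassicalEpsilon FunctionalExtensionality.
From Stdlib Require Import PropExtensionality.
From Stdlib Require Import ssreflect.
From Coquelicot Require Import Coquelicot.

Set Implicit Arguments.
Unset Strict Implicit.
Local Open Scope R_scope.

(* Completeness is that of the underlying [CompleteNormedModule]; [inner] is
   linear in its first argument. Positive definiteness of the inner product
   follows from [inner_norm] and the axioms of a normed module. *)
Record HilbertSpace := Hilbert {
  hilbert_module :> CompleteNormedModule C_AbsRing;
  inner : hilbert_module -> hilbert_module -> C;
  inner_plus : forall x y z, inner (plus x y) z = Cplus (inner x z) (inner y z);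
  inner_scal : forall (c : C) x y, inner (scal c x) y = Cmult c (inner x y);
  inner_conj : forall x y, inner y x = Cconj (inner x y);
  inner_norm : forall x, inner x x = RtoC (norm x ^ 2)
}.

Definition op_norm (H : HilbertSpace) (T : H -> H) : R :=
  real (Lub_Rbar (fun r => exists x : H, norm x <= 1 /\ r = norm (T x))).

(* [is_linear] includes boundedness; for a bounded operator defined on the
   whole space, self-adjointness is the identity [sa_adj]. *)
Record saop (H : HilbertSpace) := SAop {
  sa_fun :> H -> H;
  sa_lin : is_linear sa_fun;
  sa_adj : forall x y, inner (sa_fun x) y = inner x (sa_fun y)
}.

Section NormedModules.

Variables (K : AbsRing) (V : NormedModule K).
Implicit Types a b l t : V.

Lemma minus_zero_eq a b : minus a b = zero -> a = b.
Proof.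
intros E; rewrite -(plus_zero_l b) -E /minus.
now rewrite -plus_assoc plus_opp_l plus_zero_r.
Qed.

Lemma norm_minus_sym a b : norm (minus a b) = norm (minus b a).
Proof. now rewrite -(norm_opp (minus a b)) opp_minus. Qed.

Lemma norm_minus_plus a b la lb l :
  norm (minus l (plus la lb)) <=
  norm (minus (plus a b) l) + (norm (minus a la) + norm (minus b lb)).
Proof.
rewrite (minus_trans (plus a b) l (plus la lb)).
apply Rle_trans with (1 := norm_triangle _ _).
rewrite (norm_minus_sym l _); apply Rplus_le_compat_l.
replace (minus (plus a b) (plus la lb)) with (plus (minus a la) (minus b lb)).
- apply norm_triangle.
- rewrite /minus opp_plus -!plus_assoc; f_equal.
  rewrite !plus_assoc; f_equal; apply plus_comm.
Qed.

Lemma norm_minus_scal (k : K) a la l :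
  norm (minus l (scal k la)) <=
  norm (minus (scal k a) l) + abs k * norm (minus a la).
Proof.
rewrite (minus_trans (scal k a) l (scal k la)).
apply Rle_trans with (1 := norm_triangle _ _).
rewrite (norm_minus_sym l _); apply Rplus_le_compat_l.
rewrite -scal_minus_distr_l; apply norm_scal.
Qed.

Lemma norm_minus_trans3 a b l t :
  norm (minus b l) <= norm (minus b a) + (norm (minus t a) + norm (minus t l)).
Proof.
rewrite (minus_trans a b l).
apply Rle_trans with (1 := norm_triangle _ _); apply Rplus_le_compat_l.
rewrite (norm_minus_sym t a) (minus_trans t a l); apply norm_triangle.
Qed.

Lemma norm_le_minus b l : norm l <= norm (minus b l) + norm b.
Proof.
rewrite norm_minus_sym.
replace (norm l) with (norm (plus (minus l b) b)); [apply norm_triangle|].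
now rewrite /minus -plus_assoc plus_opp_l plus_zero_r.
Qed.

End NormedModules.

Section Operators.

Variable H : HilbertSpace.
Implicit Types (A B T : saop H) (x y : H).

Lemma hnorm_triangle x y : norm (plus x y) <= norm x + norm y.
Proof. exact (@norm_triangle C_AbsRing H x y). Qed.

Lemma hnorm_scal (c : C) x : norm (scal c x) <= Cmod c * norm x.
Proof. exact (@norm_scal C_AbsRing H c x). Qed.

Lemma hnorm_opp x : norm (opp x) = norm x.
Proof. exact (@norm_opp C_AbsRing H x). Qed.

Lemma sa_fun_plus A x y : A (plus x y) = plus (A x) (A y).
Proof. exact (linear_plus _ (sa_lin A) x y). Qed.

Lemma sa_fun_scal A (k : C) x : A (scal k x) = scal k (A x).
Proof. exact (linear_scal _ (sa_lin A) k x). Qed.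

Lemma saop_ext A B : (forall x, A x = B x) -> A = B.
Proof.
destruct A as [a la sa], B as [b lb sb]; simpl; intros E.
assert (E' : a = b) by (apply functional_extensionality; exact E).
subst b; f_equal; apply proof_irrelevance.
Qed.

Lemma inner_plus_r x y z : inner x (plus y z) = Cplus (inner x y) (inner x z).
Proof.
rewrite (inner_conj (plus y z) x) inner_plus (inner_conj y x).
rewrite (inner_conj z x).
unfold Cconj, Cplus; simpl; f_equal; ring.
Qed.

Lemma inner_scal_r (c : C) x y :
  inner x (scal c y) = Cmult (Cconj c) (inner x y).
Proof.
rewrite (inner_conj (scal c y) x) inner_scal (inner_conj y x).
unfold Cconj, Cmult; simpl; f_equal; ring.
Qed.

Lemma inner_opp x y : inner (opp x) y = Copp (inner x y).
Proof.
assert (E : opp x = scal (opp (one : C_Ring)) x)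
  by (symmetry; exact (scal_opp_one (V := H) x)).
rewrite E inner_scal.
unfold opp, one; simpl; unfold Copp, Cmult; simpl; f_equal; ring.
Qed.

Lemma inner_opp_r x y : inner x (opp y) = Copp (inner x y).
Proof.
rewrite (inner_conj (opp y) x) inner_opp (inner_conj y x).
unfold Cconj, Copp; simpl; f_equal; ring.
Qed.

Lemma Re_inner_le x y : Re (inner x y) <= norm x * norm y.
Proof.
assert (E := f_equal fst (inner_norm (plus x y))).
rewrite inner_plus !inner_plus_r !inner_norm (inner_conj x y) in E.
unfold Cconj, Cplus, RtoC in E; simpl in E.
assert (T := hnorm_triangle x y).
assert (P := norm_ge_0 (plus x y)).
assert (K : forall s a b c : R, a * (a * 1) + c + (c + b * (b * 1)) =
  s * (s * 1) -> 0 <= s -> s <= a + b -> c <= a * b) by (intros; nra).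
exact (K _ _ _ _ E P T).
Qed.

Lemma Rabs_Re_inner_le x y : Rabs (Re (inner x y)) <= norm x * norm y.
Proof.
apply Rabs_le; split; [|apply Re_inner_le].
assert (E := Re_inner_le (opp x) y).
rewrite hnorm_opp inner_opp in E.
unfold Re, Copp in *; simpl in *; lra.
Qed.

Lemma Rabs_Im_inner_le x y : Rabs (Im (inner x y)) <= norm x * norm y.
Proof.
assert (E := Rabs_Re_inner_le (scal Ci x) y).
rewrite inner_scal in E.
replace (Re (Cmult Ci (inner x y))) with (- Im (inner x y)) in E
  by (unfold Re, Im, Cmult, Ci; simpl; ring).
rewrite Rabs_Ropp in E.
apply Rle_trans with (1 := E), Rmult_le_compat_r; [apply norm_ge_0|].
apply Rle_trans with (1 := hnorm_scal Ci x).
change (abs Ci) with (Cmod Ci).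
replace (Cmod Ci) with 1; [lra|].
unfold Cmod, Ci; simpl.
replace (0 * (0 * 1) + 1 * (1 * 1)) with 1 by ring; now rewrite sqrt_1.
Qed.

Lemma op_norm_is_lub (T : H -> H) :
  is_linear T ->
  is_lub_Rbar (fun r => exists x : H, norm x <= 1 /\ r = norm (T x))
              (Finite (op_norm T)).
Proof.
intros [_ _ [M [M0 HM]]]; unfold op_norm.
set (E := fun r => _).
assert (L := Lub_Rbar_correct E).
assert (E0 : E (norm (T zero))).
{ exists zero; split; [rewrite norm_zero; lra|reflexivity]. }
assert (UB : is_ub_Rbar E (Finite M)).
{ intros r [x [Hx ->]]; simpl.
  apply Rle_trans with (1 := HM x); assert (P := norm_ge_0 x); nra. }
destruct (Lub_Rbar E) as [l| |] eqn:El; [exact L| |].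
- exfalso; destruct L as [_ L]; exact (L _ UB).
- exfalso; destruct L as [L _]; exact (L _ E0).
Qed.

Lemma op_norm_bound (T : H -> H) x :
  is_linear T -> norm (T x) <= op_norm T * norm x.
Proof.
intros lT; destruct (op_norm_is_lub lT) as [U _].
destruct (Req_dec (norm x) 0) as [N0|N0].
- destruct lT as [_ _ [M [_ HM]]]; assert (E := HM x).
  rewrite N0 in E; rewrite N0; lra.
- assert (P : 0 < norm x) by (assert (P := norm_ge_0 x); lra).
  pose (y := scal (RtoC (/ norm x)) x : H).
  assert (Ai : Cmod (RtoC (/ norm x)) = / norm x).
  { rewrite Cmod_R Rabs_pos_eq; [reflexivity|].
    left; now apply Rinv_0_lt_compat. }
  assert (Ny : norm y <= 1).
  { apply Rle_trans with (1 := hnorm_scal _ x).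
    change (Cmod (RtoC (/ norm x)) * norm x <= 1).
    rewrite Ai; right; field; exact N0. }
  assert (Ex : x = scal (RtoC (norm x)) y).
  { unfold y; rewrite scal_assoc.
    change (mult (RtoC (norm x)) (RtoC (/ norm x)))
      with (Cmult (RtoC (norm x)) (RtoC (/ norm x))).
    rewrite -RtoC_mult Rinv_r; [|exact N0].
    symmetry; apply (scal_one (K := C_AbsRing) x). }
  assert (B : norm (T y) <= op_norm T).
  { apply (U (norm (T y))); exists y; now split. }
  rewrite {1}Ex (linear_scal _ lT).
  apply Rle_trans with (1 := hnorm_scal _ _).
  change (Cmod (RtoC (norm x)) * norm (T y) <= op_norm T * norm x).
  rewrite Cmod_R Rabs_pos_eq; nra.
Qed.

Lemma op_norm_le (T : H -> H) M :
  is_linear T -> 0 <= M -> (forall x, norm (T x) <= M * norm x) ->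
  op_norm T <= M.
Proof.
intros lT M0 HM; destruct (op_norm_is_lub lT) as [_ L].
apply (L (Finite M)); intros r [x [Hx ->]]; simpl.
apply Rle_trans with (1 := HM x); assert (P := norm_ge_0 x); nra.
Qed.

Lemma op_norm_ge0 (T : H -> H) : is_linear T -> 0 <= op_norm T.
Proof.
intros lT; destruct (op_norm_is_lub lT) as [U _].
apply Rle_trans with (norm (T zero)); [apply norm_ge_0|].
apply (U (norm (T zero))); exists zero.
split; [rewrite norm_zero; lra|reflexivity].
Qed.

Lemma sa_zero_adj x y : inner (zero : H) y = inner x (zero : H).
Proof.
rewrite -{2}(scal_zero_l (K := C_AbsRing) x).
rewrite -{1}(scal_zero_l (K := C_AbsRing) y).
rewrite inner_scal inner_scal_r.
unfold zero; simpl; unfold Cmult, Cconj; simpl; f_equal; ring.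
Qed.

Lemma sa_real_scal_lin (r : R) A :
  is_linear (fun x => scal (RtoC r) (A x)).
Proof.
apply (is_linear_comp A (fun x : H => scal (RtoC r) x)); [apply sa_lin|].
apply (is_linear_scal_r (K := C_AbsRing) (V := H) (RtoC r)).
intros a b; apply Cmult_comm.
Qed.

Definition sa_zero : saop H :=
  SAop (is_linear_zero (K := C_AbsRing)) sa_zero_adj.

Definition sa_plus A B : saop H.
Proof.
refine (@SAop H (fun x => plus (A x) (B x)) _ _).
- split.
  + intros x y; rewrite !(linear_plus _ (sa_lin _)).
    rewrite -!plus_assoc; f_equal; rewrite !plus_assoc; f_equal.
    apply plus_comm.
  + intros k x; rewrite !(linear_scal _ (sa_lin _)).
    now rewrite scal_distr_l.
  + exists (op_norm A + op_norm B + 1).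
    assert (PA := op_norm_ge0 (sa_lin A)); assert (PB := op_norm_ge0 (sa_lin B)).
    split; [lra|intros x].
    apply Rle_trans with (1 := hnorm_triangle _ _).
    assert (HA := op_norm_bound x (sa_lin A)).
    assert (HB := op_norm_bound x (sa_lin B)).
    assert (P := norm_ge_0 x); nra.
- intros x y; now rewrite inner_plus inner_plus_r !sa_adj.
Defined.

Definition sa_scal (r : R) A : saop H.
Proof.
refine (@SAop H (fun x => scal (RtoC r) (A x)) (sa_real_scal_lin r A) _).
intros x y; rewrite inner_scal inner_scal_r sa_adj.
f_equal; unfold Cconj, RtoC; simpl; f_equal; ring.
Defined.

Definition sa_opp A : saop H.
Proof.
refine (@SAop H (fun x => opp (A x)) _ _).
- apply (is_linear_comp A opp); [apply sa_lin|apply is_linear_opp].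
- intros x y; now rewrite inner_opp inner_opp_r sa_adj.
Defined.

Definition saop_AbelianMonoid_mixin : AbelianMonoid.mixin_of (saop H).
Proof.
apply (AbelianMonoid.Mixin (saop H) sa_plus sa_zero).
- intros A B; apply saop_ext; intros x; apply plus_comm.
- intros A B T; apply saop_ext; intros x; apply plus_assoc.
- intros A; apply saop_ext; intros x; apply plus_zero_r.
Defined.

Canonical saop_AbelianMonoid :=
  AbelianMonoid.Pack (saop H) saop_AbelianMonoid_mixin (saop H).

Definition saop_AbelianGroup_mixin : AbelianGroup.mixin_of saop_AbelianMonoid.
Proof.
apply (AbelianGroup.Mixin saop_AbelianMonoid sa_opp).
intros A; apply saop_ext; intros x.
exact (@plus_opp_r H (A x)).
Defined.

Canonical saop_AbelianGroup :=
  AbelianGroup.Pack (saop H)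
    (AbelianGroup.Class (saop H) saop_AbelianMonoid_mixin
       saop_AbelianGroup_mixin) (saop H).

Definition saop_ModuleSpace_mixin :
  ModuleSpace.mixin_of R_Ring saop_AbelianGroup.
Proof.
apply (ModuleSpace.Mixin R_Ring saop_AbelianGroup sa_scal).
- intros a b A; apply saop_ext; intros x; simpl.
  rewrite scal_assoc; f_equal; symmetry; apply RtoC_mult.
- intros A; apply saop_ext; intros x; apply (scal_one (K := C_AbsRing)).
- intros a A B; apply saop_ext; intros x; simpl.
  exact (@scal_distr_l C_Ring H (RtoC a) (A x) (B x)).
- intros a b A; apply saop_ext; intros x; simpl.
  rewrite -(@scal_distr_r C_Ring H); f_equal; apply RtoC_plus.
Defined.

Canonical saop_ModuleSpace :=
  ModuleSpace.Pack R_Ring (saop H)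
    (ModuleSpace.Class R_Ring (saop H) (AbelianGroup.class saop_AbelianGroup)
       saop_ModuleSpace_mixin) (saop H).

Lemma saop_norm_triangle A B :
  op_norm (plus A B : saop H) <= op_norm A + op_norm B.
Proof.
assert (PA := op_norm_ge0 (sa_lin A)); assert (PB := op_norm_ge0 (sa_lin B)).
apply op_norm_le; [apply sa_lin|lra|intros x].
change ((plus A B : saop H) x) with (plus (A x) (B x)).
apply Rle_trans with (1 := hnorm_triangle _ _).
assert (HA := op_norm_bound x (sa_lin A)).
assert (HB := op_norm_bound x (sa_lin B)); lra.
Qed.

Lemma saop_norm_scal (r : R) A :
  op_norm (scal r A : saop H) <= Rabs r * op_norm A.
Proof.
assert (PA := op_norm_ge0 (sa_lin A)); assert (Pr := Rabs_pos r).
apply op_norm_le; [apply sa_lin|nra|intros x].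
change ((scal r A : saop H) x) with (scal (RtoC r) (A x)).
apply Rle_trans with (1 := hnorm_scal _ _).
change (Cmod (RtoC r) * norm (A x) <= Rabs r * op_norm A * norm x).
rewrite Cmod_R; assert (HA := op_norm_bound x (sa_lin A)); nra.
Qed.

Lemma saop_norm_eq_zero A : op_norm A = 0 -> A = zero.
Proof.
intros E; apply saop_ext; intros x.
apply (norm_eq_zero (K := C_AbsRing) (A x)).
assert (HA := op_norm_bound x (sa_lin A)); rewrite E in HA.
assert (P := norm_ge_0 (A x)); lra.
Qed.

Definition saop_ball A (e : R) B : Prop := op_norm (minus B A : saop H) < e.

Definition saop_UniformSpace_mixin : UniformSpace.mixin_of (saop H).
Proof.
apply (UniformSpace.Mixin (saop H) (zero : saop H) saop_ball).
- intros A e; unfold saop_ball; rewrite minus_eq_zero.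
  apply Rle_lt_trans with 0; [|apply cond_pos].
  apply op_norm_le; [apply sa_lin|lra|intros x].
  change ((zero : saop H) x) with (zero : H).
  rewrite norm_zero; lra.
- intros A B e; unfold saop_ball; intros HAB.
  apply Rle_lt_trans with (2 := HAB).
  rewrite -(opp_minus B A) -(scal_opp_one (K := R_Ring)).
  apply Rle_trans with (1 := saop_norm_scal _ _).
  unfold opp, one; simpl; rewrite Rabs_Ropp Rabs_R1; lra.
- intros A B T e1 e2; unfold saop_ball; intros HAB HBT.
  replace (minus T A) with (plus (minus T B) (minus B A)).
  + apply Rle_lt_trans with (1 := saop_norm_triangle _ _).
    rewrite Rplus_comm; apply Rplus_lt_compat; assumption.
  + symmetry; apply minus_trans.
Defined.

Canonical saop_UniformSpace :=
  UniformSpace.Pack (saop H) saop_UniformSpace_mixin (saop H).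

Canonical saop_NormedModuleAux :=
  NormedModuleAux.Pack R_AbsRing (saop H)
    (NormedModuleAux.Class R_AbsRing (saop H)
       (ModuleSpace.class _ saop_ModuleSpace)
       saop_UniformSpace_mixin) (saop H).

Definition saop_NormedModule_mixin :
  NormedModule.mixin_of R_AbsRing saop_NormedModuleAux.
Proof.
apply (NormedModule.Mixin R_AbsRing saop_NormedModuleAux
         (fun A : saop H => op_norm A) 1).
- exact saop_norm_triangle.
- exact saop_norm_scal.
- intros A B e HAB; exact HAB.
- intros A B e HAB; rewrite Rmult_1_l; exact HAB.
- exact saop_norm_eq_zero.
Defined.

Canonical saop_NormedModule :=
  NormedModule.Pack R_AbsRing (saop H)
    (NormedModule.Class R_AbsRing (saop H)
       (NormedModuleAux.class _ saop_NormedModuleAux)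
       saop_NormedModule_mixin) (saop H).

Lemma saop_norm_bound A x : norm (A x) <= norm A * norm x.
Proof. apply op_norm_bound, sa_lin. Qed.

Definition saop_lim (F : (saop H -> Prop) -> Prop) : saop H :=
  epsilon (inhabits (zero : saop H))
    (fun L => forall eps : posreal, F (ball L eps)).

Section Completeness.

Variable F : (saop H -> Prop) -> Prop.
Hypothesis PF : ProperFilter F.
Hypothesis CF : cauchy F.

Let ptF x (P : H -> Prop) := F (fun A => P (A x)).

Let L x : H := lim (ptF x).

Lemma saop_pointwise_lim x (eps : posreal) :
  F (fun A => norm (minus (A x) (L x)) < eps).
Proof.
assert (FF : ProperFilter (ptF x)).
{ split.
  - intros P HP; unfold ptF in HP.
    destruct (filter_ex _ HP) as [A HA]; now exists (A x).
  - split.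
    + exact (@filter_true _ F _).
    + intros P Q HP HQ; exact (@filter_and _ F _ _ _ HP HQ).
    + intros P Q I; unfold ptF; apply filter_imp; intros A; apply I. }
assert (CC : cauchy (ptF x)).
{ intros e; assert (P := norm_ge_0 x).
  assert (D : 0 < e / (norm x + 1)).
  { apply Rdiv_lt_0_compat; [apply cond_pos|lra]. }
  destruct (CF (mkposreal _ D)) as [A HA]; exists (A x).
  unfold ptF; revert HA; apply filter_imp; intros B HB.
  apply (@norm_compat1 C_AbsRing H).
  assert (E := saop_norm_bound (minus B A) x).
  change (norm (minus B A) < e / (norm x + 1)) in HB.
  apply Rle_lt_trans with (1 := E).
  assert (Q := norm_ge_0 (minus B A)).
  apply Rle_lt_trans with (e / (norm x + 1) * norm x).
  - apply Rmult_le_compat_r; lra.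
  - apply (Rmult_lt_reg_r (norm x + 1)); [lra|].
    replace (e / (norm x + 1) * norm x * (norm x + 1)) with (e * norm x)
      by (field; lra).
    assert (Pe := cond_pos e); nra. }
assert (K0 := norm_factor_gt_0 (K := C_AbsRing) (V := H)).
assert (D : 0 < eps / norm_factor (K := C_AbsRing) (V := H)).
{ apply Rdiv_lt_0_compat; [apply cond_pos|exact K0]. }
assert (E := complete_cauchy _ FF CC (mkposreal _ D)).
unfold ptF at 1 in E; revert E; apply filter_imp; intros A HA.
apply (@norm_compat2 C_AbsRing H) in HA; simpl in HA.
replace (norm_factor * (eps / norm_factor)) with (pos eps) in HA
  by (field; lra).
exact HA.
Qed.

Lemma small_norm_eq x y :
  (forall eps : posreal, norm (minus x y) < eps) -> x = y.
Proof.
intros S; apply (@minus_zero_eq C_AbsRing H), (@norm_eq_zero C_AbsRing H).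
destruct (norm_ge_0 (minus x y)) as [P|P]; [|easy].
assert (Q := S (mkposreal _ P)); simpl in Q.
exact (False_ind _ (Rlt_irrefl _ Q)).
Qed.

Lemma saop_lim_plus x y : L (plus x y) = plus (L x) (L y).
Proof.
apply small_norm_eq; intros e.
assert (D : 0 < e / 3) by (assert (P := cond_pos e); lra).
assert (E := filter_and _ _ (saop_pointwise_lim (plus x y) (mkposreal _ D))
  (filter_and _ _ (saop_pointwise_lim x (mkposreal _ D))
                  (saop_pointwise_lim y (mkposreal _ D)))).
destruct (filter_ex _ E) as [A [H1 [H2 H3]]]; simpl in *.
rewrite sa_fun_plus in H1.
assert (K : forall s a b c : R,
  s <= a + (b + c) -> a < e / 3 -> b < e / 3 -> c < e / 3 -> s < e)
  by (intros; lra).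
exact (K _ _ _ _ (@norm_minus_plus C_AbsRing H _ _ _ _ _) H1 H2 H3).
Qed.

Lemma saop_lim_scal (k : C) x : L (scal k x) = scal k (L x).
Proof.
apply small_norm_eq; intros e.
assert (Pk := Cmod_ge_0 k).
assert (D1 : 0 < e / 2) by (assert (P := cond_pos e); lra).
assert (D2 : 0 < e / 2 / (Cmod k + 1)) by (apply Rdiv_lt_0_compat; lra).
assert (E := filter_and _ _ (saop_pointwise_lim (scal k x) (mkposreal _ D1))
                            (saop_pointwise_lim x (mkposreal _ D2))).
destruct (filter_ex _ E) as [A [H1 H2]]; simpl in *.
rewrite sa_fun_scal in H1.
assert (K : forall s a b : R, s <= a + Cmod k * b -> a < e / 2 -> 0 <= b ->
  b < e / 2 / (Cmod k + 1) -> s < e).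
{ intros s a b Hs Ha Pb Hb.
  assert (M : Cmod k * b <= (Cmod k + 1) * (e / 2 / (Cmod k + 1)))
    by (apply Rmult_le_compat; lra).
  replace ((Cmod k + 1) * (e / 2 / (Cmod k + 1))) with (e / 2) in M
    by (field; lra).
  lra. }
exact (K _ _ _ (@norm_minus_scal C_AbsRing H k _ _ _) H1 (norm_ge_0 _) H2).
Qed.

Lemma saop_near_lim (eps : posreal) :
  exists A, F (ball A eps) /\
    forall B, ball A eps B ->
      forall x, norm (minus (B x) (L x)) <= 2 * eps * norm x.
Proof.
destruct (CF eps) as [A HA]; exists A; split; [exact HA|].
intros B HB x; apply Rnot_lt_le; intros N.
pose (d := norm (minus (B x) (L x)) - 2 * eps * norm x).
assert (D : 0 < d) by (unfold d; lra).
destruct (filter_ex _ (filter_and _ _ HA (saop_pointwise_lim x (mkposreal _ D))))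
  as [T [H1 H2]]; simpl in H2.
assert (K : forall s a b c nB nT : R,
  s <= a + (b + c) -> a <= nB * norm x -> b <= nT * norm x ->
  nB < eps -> nT < eps -> c < s - 2 * eps * norm x -> False).
{ intros; assert (P := norm_ge_0 x); nra. }
exact (K _ _ _ _ _ _ (@norm_minus_trans3 C_AbsRing H (A x) (B x) (L x) (T x))
  (saop_norm_bound (minus B A) x) (saop_norm_bound (minus T A) x) HB H1 H2).
Qed.

Lemma saop_lim_linear : is_linear L.
Proof.
split; [exact saop_lim_plus|exact saop_lim_scal|].
destruct (saop_near_lim (mkposreal 1 Rlt_0_1)) as [A [HA HL]]; simpl in HL.
destruct (filter_ex _ HA) as [B HB].
exists (norm B + 2); split; [assert (P := norm_ge_0 B); lra|intros x].
assert (K : forall s a b n nB : R, s <= a + b -> a <= 2 * 1 * n ->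
  b <= nB * n -> s <= (nB + 2) * n) by (intros; lra).
exact (K _ _ _ _ _ (@norm_le_minus C_AbsRing H _ _) (HL B HB x)
  (saop_norm_bound B x)).
Qed.

Lemma inner_minus_l x y z :
  inner (minus x y) z = Cminus (inner x z) (inner y z).
Proof. unfold minus; now rewrite inner_plus inner_opp. Qed.

Lemma inner_minus_r x y z :
  inner z (minus x y) = Cminus (inner z x) (inner z y).
Proof. unfold minus; now rewrite inner_plus_r inner_opp_r. Qed.

Lemma saop_lim_adj x y : inner (L x) y = inner x (L y).
Proof.
assert (K : forall (p : C -> R),
  (forall a b, p (Cminus a b) = p a - p b) ->
  (forall u v : H, Rabs (p (inner u v)) <= norm u * norm v) ->
  p (inner (L x) y) = p (inner x (L y))).
{ intros p pB pI; apply Rminus_diag_uniq.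
  set (q := _ - _).
  destruct (Req_dec q 0) as [Z|Z]; [exact Z|exfalso].
  assert (Q : 0 < Rabs q) by now apply Rabs_pos_lt.
  assert (Px := norm_ge_0 x); assert (Py := norm_ge_0 y).
  assert (D : 0 < Rabs q / (norm x + norm y + 1))
    by (apply Rdiv_lt_0_compat; lra).
  destruct (filter_ex _ (filter_and _ _
    (saop_pointwise_lim x (mkposreal _ D))
    (saop_pointwise_lim y (mkposreal _ D)))) as [A [H1 H2]]; simpl in *.
  assert (I1 := pI (minus (A x) (L x)) y).
  assert (I2 := pI x (minus (A y) (L y))).
  rewrite inner_minus_l pB in I1; rewrite inner_minus_r pB in I2.
  rewrite sa_adj in I1.
  set (d := Rabs q / (norm x + norm y + 1)) in *.
  assert (Ed : Rabs q = d * (norm x + norm y + 1))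
    by (unfold d; field; lra).
  assert (T : Rabs q <= Rabs (p (inner x (A y)) - p (inner x (L y))) +
                        Rabs (p (inner x (A y)) - p (inner (L x) y))).
  { replace q with ((p (inner x (A y)) - p (inner x (L y))) +
                    - (p (inner x (A y)) - p (inner (L x) y)))
      by (unfold q; ring).
    apply Rle_trans with (1 := Rabs_triang _ _); rewrite Rabs_Ropp; lra. }
  nra. }
apply injective_projections.
- exact (K Re (fun a b => eq_refl) Rabs_Re_inner_le).
- exact (K Im (fun a b => eq_refl) Rabs_Im_inner_le).
Qed.

Lemma saop_lim_ball (eps : posreal) : F (ball (saop_lim F) eps).
Proof.
revert eps; unfold saop_lim; apply epsilon_spec.
exists (SAop saop_lim_linear saop_lim_adj); intros eps.
assert (D : 0 < eps / 3) by (assert (P := cond_pos eps); lra).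
destruct (saop_near_lim (mkposreal _ D)) as [A [HA HL]]; simpl in HL.
revert HA; apply filter_imp; intros B HB.
change (op_norm (minus B (SAop saop_lim_linear saop_lim_adj) : saop H) < eps).
apply Rle_lt_trans with (2 * (eps / 3)); [|lra].
apply op_norm_le; [apply sa_lin|lra|exact (HL B HB)].
Qed.

End Completeness.

Definition saop_CompleteSpace_mixin :
  CompleteSpace.mixin_of saop_UniformSpace.
Proof.
apply (CompleteSpace.Mixin saop_UniformSpace saop_lim).
- exact saop_lim_ball.
- intros F1 F2 H12 H21; replace F2 with F1; [apply close_refl|].
  apply functional_extensionality; intros P.
  apply propositional_extensionality; split; [apply H21|apply H12].
Defined.

Canonical saop_CompleteSpace :=
  CompleteSpace.Pack (saop H)
    (CompleteSpace.Class (saop H) saop_UniformSpace_mixin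
       saop_CompleteSpace_mixin) (saop H).

(* The bounded self-adjoint operators form a real Banach space. *)
Canonical saop_CompleteNormedModule :=
  CompleteNormedModule.Pack R_AbsRing (saop H)
    (CompleteNormedModule.Class R_AbsRing (saop H)
       (NormedModule.class _ saop_NormedModule)
       saop_CompleteSpace_mixin) (saop H).

Definition spectrum A (z : C) : Prop :=
  ~ exists S : H -> H, is_linear S /\
      (forall x, S (minus (A x) (scal z x)) = x) /\
      (forall x, minus (A (S x)) (scal z (S x)) = x).

Definition spectrum_in (I : R -> Prop) A : Prop :=
  forall z, spectrum A z -> exists r : R, I r /\ z = RtoC r.

(* [inner (A x) x] is real since [A] is self-adjoint. *)
Definition positive_definite A : Prop :=
  (forall x, x <> zero -> 0 < Re (inner (A x) x)) /\ spectrum_in (fun r => 0 < r) A.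

Definition real_poly (c : nat -> R) (n : nat) (r : R) : R :=
  sum_n (fun k => c k * r ^ k) n.

Definition op_poly (c : nat -> R) (n : nat) A x : H :=
  sum_n (fun k => scal (RtoC (c k)) (Nat.iter k A x)) n.

(* [T] is the norm limit of [p(A)] for real polynomials [p] converging to [g]
   uniformly on the spectrum of [A]. *)
Definition is_cfc (g : R -> R) A T : Prop :=
  forall eps : posreal, exists (c : nat -> R) (n : nat),
    (forall r : R, spectrum A (RtoC r) -> Rabs (real_poly c n r - g r) < eps) /\
    op_norm (fun x => minus (op_poly c n A x) (T x)) < eps.

(* Such a [T] exists and is unique as soon as [g] is continuous on the
   spectrum of [A]; the value is arbitrary otherwise. *)
Definition cfc (g : R -> R) A : saop H :=
  epsilon (inhabits (zero : saop H)) (is_cfc g A).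

(* The norm of a bounded real-linear map on the self-adjoint operators; it is
   0 when [H] is trivial, the set being then empty. *)
Definition derivative_norm (D : saop H -> saop H) : R :=
  real (Lub_Rbar (fun r => exists B, norm B = 1 /\ r = norm (D B))).

(* [filterdiff] at the filter [locally A] is Frechet differentiability at [A];
   near a positive definite [A] every self-adjoint [X] is positive definite,
   so that the arbitrary values of [cfc f] play no role. *)
Definition class_D1 (f : R -> R) : Prop :=
  forall A, positive_definite A ->
    exists D : saop H -> saop H,
      filterdiff (cfc f) (locally A) D /\
      derivative_norm D = norm (cfc (Derive f) A).

Definition norm_cfc_convex (I : R -> Prop) (g : R -> R) : Prop :=
  forall A B, spectrum_in I A -> spectrum_in I B ->
    forall t : R, 0 <= t <= 1 ->
      norm (cfc g (plus (scal (1 - t) A) (scal t B))) <=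
      (1 - t) * norm (cfc g A) + t * norm (cfc g B).

End Operators.

(* [Derive] is total, hence the differentiability requirements at each
   order. *)
Definition class_C2_pos (f : R -> R) : Prop :=
  forall x : R, 0 < x ->
    ex_derive f x /\ ex_derive (Derive f) x /\ continuous (Derive_n f 2) x.

(* Main.v *)
Require Import Defs.
From Stdlib Require Import Reals.
From Coquelicot Require Import Coquelicot.
From Stdlib Require Import ssreflect Lra ClassicalEpsilon.
Open Scope R_scope.

(** Write [X t = (1 - t) A + t B] and [F t = f (X t)].  Integrating
    [(t - nu) F' t] by parts over [[0, 1]] gives exactly
    [nu F 0 + (1 - nu) F 1 - int F], and the chain rule gives
    [F' t = Df(X t) (B - A)].  Since [f] is in the class D1 and the norm of
    [f'] is convex,
      [|F' t| <= |f' (X t)| |B - A| <= ((1 - t) |f' A| + t |f' B|) |B - A|],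
    so the claim follows from the elementary integral of
    [|t - nu| ((1 - t) a + t b)] over [[0, 1]].

    Two points need care.

    The class D1 speaks about [X t] only once [X t] is known to be positive
    definite, spectrum included.  This goes through coercivity,
    [c |x|^2 <= <X x, x>] with [c > 0], which is evidently stable under convex
    combinations.  A positive definite operator is coercive because it is
    invertible ([positive_definite_coercive]); conversely, a coercive operator
    is invertible by the Lax-Milgram argument, applied here to suitable
    multiples of [X - z] ([coercive_positive_definite]).

    Integrating [F'] would require its continuity in [t], a separate argument.
    The integration by parts is replaced by a mean value
    inequality ([norm_increment_le]) for the primitive
    [G t = (t - nu) F t - int_0^t F], whose derivative is [(t - nu) F' t];
    this inequality reduces to the scalar mean value theorem by testing
    against the functionals [T |-> Re <T x, y>]. *)

(** * Bounded linear maps *)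

Lemma is_linear_minus {K : AbsRing} {U V : NormedModule K} {l1 l2 : U -> V} :
  is_linear l1 -> is_linear l2 -> is_linear (fun x => minus (l1 x) (l2 x)).
Proof.
move=> h1 h2.
exact: (is_linear_comp _ _
  (is_linear_prod _ _ h1 (is_linear_comp _ _ h2 is_linear_opp)) is_linear_plus).
Qed.

Lemma scal_cancel {H : HilbertSpace} (c : C) (x y : H) :
  c <> RtoC 0 -> scal c x = scal c y -> x = y.
Proof.
move=> c0 E.
have K : forall u : H, scal (Cinv c) (scal c u) = u.
{ move=> u; rewrite scal_assoc.
  change (mult (Cinv c) c) with (Cmult (Cinv c) c).
  rewrite Cinv_l //; exact: (scal_one (K := C_AbsRing) u). }
by rewrite -(K x) E K.
Qed.

(** * Coercive operators and their spectrum *)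

Section CoerciveOperators.

Variable H : HilbertSpace.
Implicit Types (x y : H) (A B : saop H).

Definition coercive (c : R) (T : H -> H) : Prop :=
  forall x, c * norm x ^ 2 <= Re (inner (T x) x).

Lemma norm_minus_sq x y :
  norm (minus x y) ^ 2 = norm x ^ 2 - 2 * Re (inner x y) + norm y ^ 2.
Proof.
have E := f_equal fst (inner_norm (minus x y)).
rewrite inner_minus_l !inner_minus_r !inner_norm (inner_conj x y) in E.
unfold Cminus, Copp, Cconj, Cplus, RtoC, Re in *; simpl in *; lra.
Qed.

(** [norm_scal] is only an inequality, as the absolute value of a general ring
    is submultiplicative; over an inner product space equality is read off from
    [<c x, c x>]. *)
Lemma hnorm_scal_eq (c : C) x : norm (scal c x) = Cmod c * norm x.
Proof.
have E := f_equal fst (inner_norm (scal c x)).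
rewrite inner_scal inner_scal_r inner_norm in E.
have K : norm (scal c x) ^ 2 = (Cmod c * norm x) ^ 2.
{ rewrite Rpow_mult_distr /Cmod pow2_sqrt; last by nra.
  unfold Cmult, Cconj, RtoC in E; simpl in E; simpl; lra. }
have P := norm_ge_0 (scal c x); have Q := Cmod_ge_0 c.
have Q' := norm_ge_0 x.
have : 0 <= Cmod c * norm x by nra.
nra.
Qed.

Lemma coercive_norm_ge c (T : H -> H) x :
  coercive c T -> c * norm x <= norm (T x).
Proof.
move=> hT; have E := hT x; have F := Re_inner_le (T x) x.
have P := norm_ge_0 x; have P' := norm_ge_0 (T x).
destruct (Req_dec (norm x) 0) as [Z|Z]; first by (rewrite Z; nra).
have : 0 < norm x by lra.
nra.
Qed.

Lemma norm_iter_le (T : H -> H) q x n :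
  0 <= q -> (forall y, norm (T y) <= q * norm y) ->
  norm (Nat.iter n T x) <= q ^ n * norm x.
Proof.
move=> q0 hT; elim: n => [|n IH] /=; first by lra.
apply: Rle_trans (hT _) _; nra.
Qed.

(** The solution is the Neumann series of the iterates [T^n y]. *)
Lemma contraction_resolvent (T : H -> H) q y :
  is_linear T -> 0 <= q < 1 -> (forall z, norm (T z) <= q * norm z) ->
  exists x, minus x (T x) = y.
Proof.
move=> lT hq hT.
pose a := fun n : nat => Nat.iter n T y : H.
have [x hx] : ex_series a.
{ apply: (ex_series_le a (fun n => scal (norm y) (q ^ n))).
  - move=> n; apply: Rle_trans (norm_iter_le T q y n (proj1 hq) hT) _.
    rewrite /scal /= /mult /=; lra.
  - exists (scal (norm y) (/ (1 - q))); apply: is_series_scal_l.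
    apply: is_series_geom; rewrite Rabs_pos_eq; lra. }
exists x.
(* The tail of the series is both [T] applied to it and the series minus its
   first term. *)
have h1 : is_series (fun n => a (S n)) (T x).
{ have Es : forall n, sum_n (fun k => a (S k)) n = T (sum_n a n).
  { elim=> [|n IH]; first by rewrite !sum_O.
    rewrite !sum_Sn (linear_plus _ lT) IH //. }
  apply: (filterlim_ext (fun n => T (sum_n a n))).
  - by move=> n; rewrite Es.
  - apply: filterlim_comp hx _; exact: linear_cont lT. }
have h2 : is_series (fun n => a (S n)) (minus x y).
{ apply: is_series_incr_1; rewrite /minus -plus_assoc /a /=.
  rewrite plus_opp_l plus_zero_r; exact: hx. }
rewrite (filterlim_locally_unique _ _ _ h1 h2).
by rewrite /minus opp_plus opp_opp plus_assoc plus_opp_r plus_zero_l.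
Qed.

(** Lax-Milgram: for small [s > 0] the map [1 - s T] is a contraction, because
      [|x - s T x|^2 <= (1 - 2 s c + s^2 M^2) |x|^2]
    when [M] bounds [T]; hence [s T = 1 - (1 - s T)] is onto. *)
Lemma coercive_surjective (T : H -> H) c y :
  is_linear T -> 0 < c -> coercive c T -> exists x, T x = y.
Proof.
move=> lT c0 hT.
(* Adding [c] makes [M] positive and keeps [q] well defined, as [c <= M];
   the choice of [s] minimises the factor [1 - 2 s c + s^2 M^2]. *)
pose M := op_norm T + c.
have M0 := op_norm_ge0 lT.
have Mc : c <= M by rewrite /M; lra.
pose s := c / M ^ 2; pose q := sqrt (1 - c ^ 2 / M ^ 2).
have s0 : 0 < s by apply: Rdiv_lt_0_compat; nra.
have r0 : 0 < c ^ 2 / M ^ 2 by apply: Rdiv_lt_0_compat; nra.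
have r1 : c ^ 2 / M ^ 2 <= 1.
{ apply: (Rmult_le_reg_r (M ^ 2)); first by nra.
  rewrite /Rdiv Rmult_assoc Rinv_l; last by nra.
  nra. }
have hq : 0 <= q < 1.
{ split; first exact: sqrt_pos.
  rewrite -sqrt_1; apply: sqrt_lt_1; lra. }
pose R := fun x => minus x (scal (RtoC s) (T x)) : H.
have lR : is_linear (fun x => scal (RtoC s) (T x) : H).
{ apply: (is_linear_comp T (fun x : H => scal (RtoC s) x)) => //.
  apply: (is_linear_scal_r (K := C_AbsRing) (V := H) (RtoC s)).
  move=> a b; exact: Cmult_comm. }
have hc : forall z, norm (R z) <= q * norm z.
{ move=> z; have Pz := norm_ge_0 z.
  have P : 0 <= q * norm z by nra.
  apply: Rsqr_incr_0_var => //.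
  rewrite !Rsqr_pow2 norm_minus_sq hnorm_scal_eq Cmod_R Rabs_pos_eq; last lra.
  rewrite inner_scal_r.
  have -> : Re (Cmult (Cconj (RtoC s)) (inner z (T z))) = s * Re (inner (T z) z).
  { rewrite (inner_conj (T z) z) /Re /Cmult /Cconj /RtoC /=; ring. }
  have -> : (q * norm z) ^ 2 = (1 - c ^ 2 / M ^ 2) * norm z ^ 2.
  { rewrite Rpow_mult_distr /q pow2_sqrt //; lra. }
  have h := hT z; have B := op_norm_bound z lT.
  have B2 : norm (T z) ^ 2 <= M ^ 2 * norm z ^ 2.
  { rewrite -Rpow_mult_distr; apply: pow_incr; split; first exact: norm_ge_0.
    apply: Rle_trans B _; apply: Rmult_le_compat_r => //; rewrite /M; lra. }
  have Es : s ^ 2 * M ^ 2 = c ^ 2 / M ^ 2 by rewrite /s; field; lra.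
  have Es' : s * c = c ^ 2 / M ^ 2 by rewrite /s; field; lra.
  have K1 : s * (c * norm z ^ 2) <= s * Re (inner (T z) z).
  { apply: Rmult_le_compat_l => //; lra. }
  have K2 : (s * norm (T z)) ^ 2 <= (s ^ 2 * M ^ 2) * norm z ^ 2.
  { rewrite Rpow_mult_distr Rmult_assoc; apply: Rmult_le_compat_l => //.
    exact: pow2_ge_0. }
  rewrite Es in K2; rewrite -Rmult_assoc Es' in K1; lra. }
have lR' : is_linear R := is_linear_minus is_linear_id lR.
have [x hx] := contraction_resolvent R q (scal (RtoC s) y) lR' hq hc.
exists x; apply: (scal_cancel (RtoC s)).
- move=> E; have := f_equal fst E; rewrite /RtoC /=; lra.
- rewrite -hx /R; symmetry.
  by rewrite /minus opp_plus opp_opp plus_assoc plus_opp_r plus_zero_l.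
Qed.

Lemma coercive_bijective (T : H -> H) c :
  is_linear T -> 0 < c -> coercive c T ->
  exists S : H -> H, is_linear S /\
    (forall x, S (T x) = x) /\ (forall x, T (S x) = x).
Proof.
move=> lT c0 hT.
have inj : forall x y, T x = T y -> x = y.
{ move=> x y E; apply: (@minus_zero_eq C_AbsRing H).
  apply: (@norm_eq_zero C_AbsRing H).
  have K := coercive_norm_ge c T (minus x y) hT.
  rewrite (linear_minus _ _ _ lT) E minus_eq_zero norm_zero in K.
  have P := norm_ge_0 (minus x y).
  apply: Rle_antisym => //; apply: (Rmult_le_reg_l c) => //.
  by rewrite Rmult_0_r. }
pose S := fun y => epsilon (inhabits (zero : H)) (fun x => T x = y).
have TS : forall y, T (S y) = y.
{ move=> y; apply: (epsilon_spec (inhabits (zero : H)) (fun x => T x = y)).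
  exact: coercive_surjective lT c0 hT. }
exists S; repeat split => //.
- by move=> x y; apply: inj; rewrite (linear_plus _ lT) !TS.
- by move=> k x; apply: inj; rewrite (linear_scal _ lT) !TS.
- exists (/ c); split; first exact: Rinv_0_lt_compat.
  move=> x; apply: (Rmult_le_reg_l c) => //.
  rewrite -Rmult_assoc Rinv_r; last lra.
  rewrite Rmult_1_l -{2}(TS x); exact: coercive_norm_ge.
- by move=> x; apply: inj; rewrite TS.
Qed.

(** Multiplying by [w] rotates and scales the numerical range of [A - z], so
    that it suffices to separate it from 0 by some half-plane. *)
Lemma not_spectrum_of_coercive A (z w : C) d :
  0 < d -> coercive d (fun x => scal w (minus (A x) (scal z x))) ->
  ~ spectrum A z.
Proof.
move=> d0 hc; apply.
have comm : forall a b : C_AbsRing, mult a b = mult b a := Cmult_comm.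
have lz : is_linear (fun x : H => scal z x) := is_linear_scal_r z comm.
have lw : is_linear (fun x : H => scal w x) := is_linear_scal_r w comm.
have lD := is_linear_minus (sa_lin A) lz.
have [S [lS [ST TS]]] := coercive_bijective _ d (is_linear_comp _ _ lD lw) d0 hc.
exists (fun x => S (scal w x)); repeat split => //.
- by move=> x y; rewrite (linear_plus _ lw) (linear_plus _ lS).
- by move=> k x; rewrite (linear_scal _ lw) (linear_scal _ lS).
- exact: (linear_norm _ (is_linear_comp _ _ lw lS)).
- move=> x; case: (Ceq_dec w (RtoC 0)) => [w0|wn0].
  + (* For [w = 0] the inverse of the zero map exists only if the space is
       trivial. *)
    have E0 := TS x; have E1 := TS (minus (A (S (scal w x))) (scal z (S (scal w x)))).
    move: E0 E1; rewrite w0.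
    have Z : forall u : H, scal (RtoC 0) u = zero := scal_zero_l (K := C_Ring).
    by rewrite !Z => <- <-.
  + apply: (scal_cancel w) => //; exact: TS.
Qed.

(** As [<A x, x>] is real and at least [c |x|^2], the numerical range of
    [A - z] lies in the right half-plane when [z <= 0] and strictly on one side
    of the real axis when [z] is not real. *)
Lemma coercive_positive_definite A c :
  0 < c -> coercive c A -> positive_definite A.
Proof.
move=> c0 hA; split.
- move=> x x0; apply: Rlt_le_trans (hA x).
  have P := norm_ge_0 x.
  have N : norm x <> 0 by move=> N; apply: x0; exact: (@norm_eq_zero C_AbsRing H).
  apply: Rmult_lt_0_compat => //; apply: pow_lt; lra.
- move=> [p q] hz.
  case: (Req_dec q 0) => [q0|q0].
  + exists p; split; last by rewrite q0.
    apply: Rnot_le_lt => p0; move: hz.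
    apply: (not_spectrum_of_coercive A _ (RtoC 1) c) => // x.
    rewrite inner_scal inner_minus_l inner_scal inner_norm q0.
    have := hA x; rewrite /Re /Cmult /Cminus /Cplus /Copp /RtoC /=.
    have := norm_ge_0 x; nra.
  + case: (not_spectrum_of_coercive A (p, q) (0, q) (q ^ 2) _ _ hz).
    * nra.
    * move=> x.
      rewrite inner_scal inner_minus_l inner_scal inner_norm.
      have R0 : snd (inner (A x) x) = 0.
      { have := f_equal snd (inner_conj (A x) x); rewrite -sa_adj /=; lra. }
      rewrite /Re /Cmult /Cminus /Cplus /Copp /RtoC /= R0; nra.
Qed.

(** The form [<A x, y>] is nonnegative, so evaluating it at [M x - A x], where
    [M] bounds [A], gives the Cauchy-Schwarz type bound
    [|A x|^2 <= M <A x, x>].  As 0 is not in the spectrum, [|x| <= K |A x|] for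
    a bound [K] of the inverse. *)
Lemma positive_definite_coercive A :
  positive_definite A -> exists c, 0 < c /\ coercive c A.
Proof.
move=> [posA spA].
have [S [lS [SA _]]] : exists S : H -> H, is_linear S /\
      (forall x, S (minus (A x) (scal (RtoC 0) x)) = x) /\
      (forall x, minus (A (S x)) (scal (RtoC 0) (S x)) = x).
{ apply: Classical_Prop.NNPP => N; have [r [r0 E]] := spA _ N.
  have := f_equal fst E; rewrite /RtoC /=; lra. }
have nonneg : forall x, 0 <= Re (inner (A x) x).
{ move=> x; case: (Classical_Prop.classic (x = zero)) => [->|x0].
  - rewrite (linear_zero _ (sa_lin A)).
    have := f_equal fst (inner_norm (zero : H)).
    rewrite norm_zero /Re /RtoC /= => ->; lra.
  - left; exact: posA. }
have [K [K0 hK]] := linear_norm _ lS.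
pose M := norm A + 1.
have M0 : 0 < M by rewrite /M; move: (norm_ge_0 A); lra.
have KM0 : 0 < K ^ 2 * M by apply: Rmult_lt_0_compat => //; exact: pow_lt.
exists (/ (K ^ 2 * M)); split; first exact: Rinv_0_lt_compat.
move=> x; apply: (Rmult_le_reg_l (K ^ 2 * M)) => //.
rewrite -Rmult_assoc Rinv_r; last lra.
rewrite Rmult_1_l.
have N1 : norm x <= K * norm (A x).
{ have := hK (minus (A x) (scal (RtoC 0) x)); rewrite SA.
  by rewrite (scal_zero_l (K := C_Ring)) minus_zero_r. }
have N2 : norm (A x) ^ 2 <= M * Re (inner (A x) x).
{ have h := nonneg (minus (scal (RtoC M) x) (A x)).
  rewrite (linear_minus _ _ _ (sa_lin A)) (linear_scal _ (sa_lin A)) in h.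
  rewrite inner_minus_l !inner_minus_r !inner_scal !inner_scal_r in h.
  rewrite (sa_adj A (A x) x) inner_norm in h.
  have B : Re (inner (A (A x)) (A x)) <= M * norm (A x) ^ 2.
  { apply: Rle_trans (Re_inner_le _ _) _.
    have N := norm_ge_0 (A x).
    replace (M * norm (A x) ^ 2) with ((M * norm (A x)) * norm (A x)) by ring.
    apply: Rmult_le_compat_r => //.
    apply: Rle_trans (saop_norm_bound _ _) _.
    apply: Rmult_le_compat_r => //; rewrite /M; lra. }
  move: h B; rewrite /Re /Cmult /Cconj /Cminus /Cplus /Copp /RtoC /=.
  set a := fst _; set b := fst _; move=> h B.
  nra. }
have P := norm_ge_0 x; have P' := norm_ge_0 (A x).
have N3 : norm x ^ 2 <= K ^ 2 * norm (A x) ^ 2.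
{ rewrite -Rpow_mult_distr; exact: pow_incr. }
nra.
Qed.

End CoerciveOperators.

(** * Mean value inequality and weighted trapezoid rule *)

Lemma norm_scal_pos (V : NormedModule R_AbsRing) (k : R) (x : V) :
  0 < k -> norm (scal k x) = k * norm x.
Proof.
move=> k0; have i0 := Rinv_0_lt_compat k k0.
apply: Rle_antisym.
- have := norm_scal k x; rewrite /abs /= Rabs_pos_eq //; lra.
- have := norm_scal (/ k) (scal k x); rewrite scal_assoc.
  change (mult (/ k) k) with (/ k * k); rewrite Rinv_l; last lra.
  change (scal 1 x) with (scal (one : R_Ring) x).
  rewrite scal_one /abs /= Rabs_pos_eq; last lra.
  move=> h; apply: (Rmult_le_reg_l (/ k)) => //.
  rewrite -Rmult_assoc Rinv_l; lra.
Qed.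

Section Calculus.
Variable H : HilbertSpace.

Lemma is_linear_Re_inner (x y : H) :
  is_linear (fun T : saop H => Re (inner (T x) y)).
Proof.
split.
- move=> S T; change ((plus S T : saop H) x) with (plus (S x) (T x)).
  by rewrite inner_plus.
- move=> k T; change ((scal k T : saop H) x) with (scal (RtoC k) (T x)).
  rewrite inner_scal /Re /Cmult /RtoC /scal /= /mult /=; ring.
- exists (norm x * norm y + 1).
  have P := norm_ge_0 x; have Q := norm_ge_0 y.
  split; first by nra.
  move=> T; apply: Rle_trans (Rabs_Re_inner_le _ _) _.
  have B := saop_norm_bound T x; have N := norm_ge_0 T; nra.
Qed.

(** Testing against [y = T x] recovers [|T x|^2]. *)
Lemma saop_norm_le (T : saop H) M :
  0 <= M -> (forall x y, Re (inner (T x) y) <= M * norm x * norm y) ->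
  norm T <= M.
Proof.
move=> M0 hT; apply: op_norm_le => //; first exact: sa_lin.
move=> x; have h := hT x (T x).
rewrite inner_norm /Re /RtoC /= in h.
have P := norm_ge_0 (T x); have Q := norm_ge_0 x.
case: (Req_dec (norm (T x)) 0) => Z; first by (rewrite Z; nra).
have : 0 < norm (T x) by lra.
nra.
Qed.

(** For fixed [x] and [y] the real function
    [|x| |y| P t - Re <G t x, y>] has a nonnegative derivative, hence increases. *)
Lemma norm_increment_le (G G' : R -> saop H) (P p : R -> R) u v :
  u <= v ->
  (forall t, u <= t <= v -> continuous G t) ->
  (forall t, u < t < v -> is_derive G t (G' t)) ->
  (forall t, is_derive P t (p t)) ->
  (forall t, u <= t <= v -> norm (G' t) <= p t) ->
  norm (minus (G v) (G u)) <= P v - P u.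
Proof.
move=> uv cG dG dP hp.
have Pm : 0 <= P v - P u.
{ have [c [hc ->]] := MVT_gen P u v p (fun t _ => dP t)
    (fun t _ => proj2 (continuity_pt_filterlim P t)
      (ex_derive_continuous P t (ex_intro _ _ (dP t)))).
  rewrite Rmin_left // Rmax_right // in hc.
  have := hp c hc; have := norm_ge_0 (G' c); nra. }
apply: saop_norm_le => // x y.
pose l := fun T : saop H => Re (inner (T x) y).
have ll : is_linear l := is_linear_Re_inner x y.
pose k := norm x * norm y.
have Px := norm_ge_0 x; have Py := norm_ge_0 y.
have k0 : 0 <= k by rewrite /k; nra.
pose phi := fun t => k * P t - l (G t).
have dphi : forall t, u < t < v -> is_derive phi t (k * p t - l (G' t)).
{ move=> t ht; apply: (@is_derive_minus R_AbsRing R_NormedModule).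
  - exact: is_derive_scal.
  - have K := filterdiff_comp' G l t _ _ (dG t ht) (filterdiff_linear l ll).
    by apply: filterdiff_ext_lin K _ => s; rewrite (linear_scal _ ll). }
have cphi : forall t, u <= t <= v -> continuity_pt phi t.
{ move=> t ht; apply/continuity_pt_filterlim.
  apply: (@continuous_minus _ R_AbsRing R_NormedModule
            (fun s => k * P s) (fun s => l (G s))).
  - apply: ex_derive_continuous; exists (k * p t); exact: is_derive_scal.
  - apply: (continuous_comp G l); first exact: cG.
    exact: linear_cont. }
have [c [hc E]] : exists c, u <= c <= v /\
    phi v - phi u = (k * p c - l (G' c)) * (v - u).
{ have := MVT_gen phi u v (fun t => k * p t - l (G' t)).
  rewrite Rmin_left // Rmax_right //; apply => // t ht; exact: cphi. }
have B : l (G' c) <= k * p c.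
{ apply: Rle_trans (Re_inner_le _ _) _.
  have -> : k * p c = (p c * norm x) * norm y by rewrite /k; ring.
  apply: Rmult_le_compat_r => //.
  apply: Rle_trans (saop_norm_bound _ _) _.
  apply: Rmult_le_compat_r => //; exact: hp. }
have D : l (minus (G v) (G u)) = l (G v) - l (G u) := linear_minus _ _ _ ll.
rewrite -/(l (minus (G v) (G u))) D.
have : 0 <= phi v - phi u by rewrite E; nra.
rewrite /phi -/(Rminus _ _) Rmult_assoc -/k; lra.
Qed.

(** This is [norm_increment_le] for [G t = (t - nu) F t - int_0^t F], on
    [[0, nu]] and [[nu, 1]] separately because the bound on the derivative
    [(t - nu) F' t] changes expression at [nu]. *)
Lemma weighted_trapezoid (F F' : R -> saop H) nu a b :
  0 <= nu <= 1 ->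
  (forall t, 0 <= t <= 1 -> is_derive F t (F' t)) ->
  (forall t, 0 <= t <= 1 -> norm (F' t) <= (1 - t) * a + t * b) ->
  norm (minus (plus (scal nu (F 0)) (scal (1 - nu) (F 1))) (RInt F 0 1)) <=
  1 / 6 * (2 * (1 - nu) ^ 3 - 3 * (1 - nu) + 2) * a
  + 1 / 6 * (2 * nu ^ 3 - 3 * nu + 2) * b.
Proof.
move=> hnu dF hF.
have cF : forall t, 0 <= t <= 1 -> continuous F t.
{ move=> t ht; apply: ex_derive_continuous; exists (F' t); exact: dF. }
(* Replacing [F] by an extension that is continuous on the whole line gives
   the primitive a two-sided derivative at the end points as well. *)
have [g [cg Eg]] := C0_extension_le F 0 1 cF.
pose G := fun t => minus (scal (t - nu) (g t)) (RInt g 0 t) : saop H.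
have dI : forall t, is_derive (fun t => RInt g 0 t) t (g t).
{ move=> t; apply: (is_derive_RInt g _ 0); last exact: cg.
  apply: filter_forall => s; apply: RInt_correct.
  apply: ex_RInt_continuous => z _; exact: cg. }
have cG : forall t, continuous G t.
{ move=> t; apply: continuous_minus.
  - apply: continuous_scal; last exact: cg.
    apply: (@continuous_minus _ R_AbsRing R_NormedModule);
      [exact: continuous_id|exact: continuous_const].
  - apply: ex_derive_continuous; exists (g t); exact: dI. }
have dG : forall t, 0 < t < 1 -> is_derive G t (scal (t - nu) (F' t)).
{ move=> t ht.
  have Et : scal (t - nu) (F' t) =
    minus (plus (scal 1 (g t)) (scal (t - nu) (F' t))) (g t).
  { rewrite (scal_one (K := R_AbsRing) (g t)) /minus (plus_comm (g t)).
    by rewrite -plus_assoc plus_opp_r plus_zero_r. }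
  rewrite Et; apply: is_derive_minus; last exact: dI.
  have dg : is_derive g t (F' t).
  { apply: is_derive_ext_loc (dF t _); last lra.
    have L : locally t (fun s => 0 < s < 1).
    { apply: (open_and (fun s : R => 0 < s) (fun s => s < 1)
        (open_gt 0) (open_lt 1)); lra. }
    apply: filter_imp L => s hs; symmetry; apply: Eg; lra. }
  have d1 : is_derive (fun s : R => s - nu) t 1.
  { auto_derive => //. }
  have K := filterdiff_scal_fct t (fun s : R => s - nu) g _ _ Rmult_comm d1 dg.
  apply: filterdiff_ext_lin K _ => s.
  rewrite scal_distr_l !scal_assoc; f_equal; f_equal.
  exact: Rmult_comm. }
have Ndot : forall t, 0 <= t <= 1 ->
  norm (scal (t - nu) (F' t)) <= Rabs (t - nu) * ((1 - t) * a + t * b).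
{ move=> t ht; apply: Rle_trans (norm_scal _ _) _.
  apply: Rmult_le_compat_l (Rabs_pos _) _; exact: hF. }
pose P := fun t => (a * (t ^ 2 / 2 - t ^ 3 / 3) + b * t ^ 3 / 3)
  - nu * (a * (t - t ^ 2 / 2) + b * t ^ 2 / 2).
pose p := fun t => (t - nu) * ((1 - t) * a + t * b).
have dP : forall t, is_derive P t (p t).
{ move=> t; rewrite /P /p; auto_derive => //; field. }
have N1 : norm (minus (G nu) (G 0)) <= - P nu - - P 0.
{ apply: (norm_increment_le G (fun t => scal (t - nu) (F' t)) (fun t => - P t)
    (fun t => - p t)).
  - lra.
  - move=> t _; exact: cG.
  - move=> t ht; apply: dG; lra.
  - move=> t; exact: is_derive_opp.
  - move=> t ht; apply: Rle_trans (Ndot t _) _; first lra.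
    rewrite Rabs_left1; [rewrite /p; lra|lra]. }
have N2 : norm (minus (G 1) (G nu)) <= P 1 - P nu.
{ apply: (norm_increment_le G (fun t => scal (t - nu) (F' t)) P p) => //.
  - lra.
  - move=> t ht; apply: dG; lra.
  - move=> t ht; apply: Rle_trans (Ndot t _) _; first lra.
    rewrite Rabs_pos_eq; [rewrite /p; lra|lra]. }
have E : minus (plus (scal nu (F 0)) (scal (1 - nu) (F 1))) (RInt F 0 1)
   = plus (minus (G 1) (G nu)) (minus (G nu) (G 0)).
{ rewrite -minus_trans /G.
  have -> : RInt F 0 1 = RInt g 0 1.
  { apply: RInt_ext => t; rewrite Rmin_left ?Rmax_right; try lra.
    move=> ht; symmetry; apply: Eg; lra. }
  rewrite !Eg; try lra.
  rewrite RInt_point minus_zero_r.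
  have -> : 0 - nu = opp nu by rewrite /opp /=; ring.
  rewrite scal_opp_l /minus opp_opp.
  rewrite -!plus_assoc (plus_comm (opp _)) plus_assoc.
  by rewrite (plus_comm (scal nu _)) -plus_assoc. }
rewrite E; apply: Rle_trans (norm_triangle _ _) _.
apply: Rle_trans (Rplus_le_compat _ _ _ _ N2 N1) _.
right; rewrite /P; field.
Qed.

(** For [B <> 0] one normalises [B]; the bound contained in [is_linear] makes
    the least upper bound finite. *)
Lemma derivative_norm_bound (D : saop H -> saop H) (B : saop H) :
  is_linear D -> norm (D B) <= derivative_norm D * norm B.
Proof.
move=> lD; have PB := norm_ge_0 B.
case: (Req_dec (norm B) 0) => [B0|B0].
- by rewrite (norm_eq_zero _ B0) (linear_zero _ lD) !norm_zero; lra.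
- have [M [M0 hM]] := linear_norm _ lD.
  rewrite /derivative_norm; set E := fun r => _.
  have [U L] := Lub_Rbar_correct E.
  pose C := scal (/ norm B) B : saop H.
  have i0 : 0 < / norm B by apply: Rinv_0_lt_compat; lra.
  have EC : E (norm (D C)).
  { exists C; split => //; rewrite /C norm_scal_pos //. by field. }
  have UM : is_ub_Rbar E (Finite M).
  { move=> r [T [T1 ->]] /=; have := hM T; rewrite T1; lra. }
  have h : norm (D C) <= real (Lub_Rbar E).
  { have U' := U _ EC; have L' := L _ UM.
    by destruct (Lub_Rbar E). }
  rewrite /C (linear_scal _ lD) norm_scal_pos // in h.
  apply: (Rmult_le_reg_l (/ norm B)) => //.
  rewrite (Rmult_comm (real _)) -Rmult_assoc Rinv_l //; lra.
Qed.

End Calculus.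

(** * The segment between two positive definite operators *)

Section Segment.

Variable H : HilbertSpace.
Implicit Types A B : saop H.

Definition segment A B (t : R) : saop H := plus (scal (1 - t) A) (scal t B).

Lemma segment_positive_definite A B t :
  positive_definite A -> positive_definite B -> 0 <= t <= 1 ->
  positive_definite (segment A B t).
Proof.
move=> hA hB ht.
have [a [a0 ha]] := positive_definite_coercive _ _ hA.
have [b [b0 hb]] := positive_definite_coercive _ _ hB.
apply: (coercive_positive_definite _ _ ((1 - t) * a + t * b)).
- case: (Req_dec t 0) => [->|t0]; first lra.
  have : 0 < t * b by apply: Rmult_lt_0_compat => //; lra.
  have : 0 <= (1 - t) * a by apply: Rmult_le_pos; lra.
  lra.
- move=> x.
  have -> : inner (segment A B t x) x =
    Cplus (Cmult (RtoC (1 - t)) (inner (A x) x)) (Cmult (RtoC t) (inner (B x) x)).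
  { by rewrite -!inner_scal -inner_plus. }
  have -> : forall u v : C,
    Re (Cplus (Cmult (RtoC (1 - t)) u) (Cmult (RtoC t) v)) =
    (1 - t) * Re u + t * Re v.
  { move=> u v; rewrite /Re /Cplus /Cmult /RtoC /=; ring. }
  have h1 : (1 - t) * (a * norm x ^ 2) <= (1 - t) * Re (inner (A x) x).
  { apply: Rmult_le_compat_l; [lra|exact: ha]. }
  have h2 : t * (b * norm x ^ 2) <= t * Re (inner (B x) x).
  { apply: Rmult_le_compat_l; [lra|exact: hb]. }
  lra.
Qed.

Lemma is_derive_segment A B t : is_derive (segment A B) t (minus B A).
Proof.
have -> : minus B A = plus (scal (-1) A) (scal 1 B).
{ change (-1) with (opp (one : R_Ring)); change 1 with (one : R_Ring).
  by rewrite scal_opp_one scal_one plus_comm. }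
apply: is_derive_plus; apply: (is_derive_scal_l (K := R_AbsRing)).
- by auto_derive => //; ring.
- exact: is_derive_id.
Qed.

(** The chain rule identifies the derivative as [Df] at the point of
    parameter [t], applied to [B - A]; the D1 identity turns its norm into that
    of [f'] there, and convexity passes to the end points. *)
Lemma is_derive_cfc_segment (f : R -> R) A B t :
  class_D1 H f -> norm_cfc_convex H (fun r => 0 < r) (Derive f) ->
  positive_definite A -> positive_definite B -> 0 <= t <= 1 ->
  exists d, is_derive (fun s => cfc f (segment A B s)) t d /\
    norm d <= (1 - t) * (norm (cfc (Derive f) A) * norm (minus B A)) +
              t * (norm (cfc (Derive f) B) * norm (minus B A)).
Proof.
move=> fD fc hA hB ht.
have [D [dD nD]] := fD _ (segment_positive_definite A B t hA hB ht).
have lD : is_linear D := proj1 dD.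
exists (D (minus B A)); split.
- have K := filterdiff_comp' (segment A B) (cfc f) t _ _
    (is_derive_segment A B t) dD.
  by apply: filterdiff_ext_lin K _ => s; rewrite (linear_scal _ lD).
- apply: Rle_trans (derivative_norm_bound _ D (minus B A) lD) _.
  rewrite nD -!Rmult_assoc -Rmult_plus_distr_r.
  apply: Rmult_le_compat_r; first exact: norm_ge_0.
  exact: fc (proj2 hA) (proj2 hB) t ht.
Qed.

End Segment.

Arguments segment {H} A B t.

Theorem proposition2 (H : HilbertSpace) (f : R -> R)
    (f_C2 : class_C2_pos f)
    (f_D1 : class_D1 H f)
    (f'_convex : norm_cfc_convex H (fun r => 0 < r) (Derive f))
    (A B : saop H) (hA : positive_definite A) (hB : positive_definite B)
    (nu : R) (hnu : 0 <= nu <= 1) :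
  norm (minus (plus (scal nu (cfc f A)) (scal (1 - nu) (cfc f B)))
              (RInt (fun t => cfc f (plus (scal (1 - t) A) (scal t B))) 0 1))
  <= 1 / 6 * (2 * (1 - nu) ^ 3 - 3 * (1 - nu) + 2)
       * norm (cfc (Derive f) A) * norm (minus B A)
     + 1 / 6 * (2 * nu ^ 3 - 3 * nu + 2)
       * norm (cfc (Derive f) B) * norm (minus B A).
Proof.
pose a := norm (cfc (Derive f) A) * norm (minus B A).
pose b := norm (cfc (Derive f) B) * norm (minus B A).
pose F := fun t => cfc f (segment A B t).
pose bounded_derivative := fun t d =>
  is_derive F t d /\ norm d <= (1 - t) * a + t * b.
pose F' := fun t => epsilon (inhabits (zero : saop H)) (bounded_derivative t).
have hF' : forall t, 0 <= t <= 1 -> bounded_derivative t (F' t).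
{ move=> t ht; apply: epsilon_spec; exact: is_derive_cfc_segment. }
have K := weighted_trapezoid H F F' nu a b hnu
  (fun t ht => proj1 (hF' t ht)) (fun t ht => proj2 (hF' t ht)).
have F0 : F 0 = cfc f A.
{ rewrite /F /segment Rminus_0_r (scal_one (K := R_AbsRing) A).
  by rewrite (scal_zero_l (K := R_AbsRing) B) plus_zero_r. }
have F1 : F 1 = cfc f B.
{ rewrite /F /segment Rminus_diag (scal_zero_l (K := R_AbsRing) A).
  by rewrite (scal_one (K := R_AbsRing) B) plus_zero_l. }
rewrite F0 F1 in K.
by apply: Rle_trans K _; right; rewrite /a /b; ring.
Qed.
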